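(* Let $(X,d)$ be a Hadamard space and let $F:X\to X$ be a nonexpansive mapping with associated semigroup $(T_t)_{t\geq0}$. Let $y\in\mathrm{Fix}F$, $x\in X$ and let $b\in\mathbb{N}$, $b\geq1$, with $d(x,y)\leq b$. Let $\bar F:X\to[0,+\infty]$ be given by $\bar F(z):=d(z,F(z))$ if $d(z,y)\leq b$ and $\bar F(z):=+\infty$ otherwise, and assume that $\bar F$ has a modulus of regularity $\tau$ w.r.t. $\overline{B}_b(y)$. Then, with $\rho(\varepsilon):=\left\lceil(4b/\tau(\varepsilon))\cdot e^{4b/\tau(\varepsilon)}\right\rceil+1$: \[ \forall\varepsilon>0\ \forall t\geq\rho(\varepsilon)\ (\mathrm{dist}(T_t(x),\mathrm{Fix}F)<\varepsilon)\quad\text{and}\quad\forall\varepsilon>0\ \forall t,s\geq\rho(\varepsilon/2)\ (d(T_t(x),T_s(x))<\varepsilon). \] In particular, $T_t(x)$ converges as $t\to\infty$ to a fixed point $x^*$ of $F$ with that rate, i.e. $d(T_t(x),x^* )\leq\varepsilon$ for all $\varepsilon>0$ and $t\geq\rho(\varepsilon/2)$.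
   Context: $\mathbb{N}$ contains $0$. A Hadamard space is a complete geodesic metric space of nonpositive curvature in the sense of Alexandrov (complete CAT(0) space); it is uniquely geodesic, and $(1-\lambda)u\oplus\lambda v$ denotes the point $w$ on the geodesic from $u$ to $v$ with $d(u,w)=\lambda d(u,v)$ and $d(v,w)=(1-\lambda)d(u,v)$. For $x\in X$ and $t>0$, $R_t(x)$ is the unique fixed point of the strict contraction $G_{x,t}(u):=\frac{1}{1+t}x\oplus\frac{t}{1+t}F(u)$ ($R_0:=\mathrm{Id}$), and $T_t(x):=\lim_{n\to\infty}(R_{t/n})^{(n)}(x)$ for $t\geq0$, where $(\cdot)^{(n)}$ denotes $n$-fold iteration (this limit exists and $(T_t)$ is a nonexpansive semigroup). $\mathrm{Fix}F$ is the set of fixed points of $F$, and $\overline{B}_b(y)$ is the closed ball. With $\mathrm{zer}\bar F:=\{z\in X\mid\bar F(z)=0\}$ (here equal to $\mathrm{Fix}F\cap\overline{B}_b(y)$), a modulus of regularity for $\bar F$ w.r.t. $\overline{B}_b(y)$ is a function $\tau:(0,\infty)\to(0,\infty)$ such that for all $\varepsilon>0$ and all $u\in\overline{B}_b(y)$: $\bar F(u)<\tau(\varepsilon)$ implies $\mathrm{dist}(u,\mathrm{zer}\bar F)<\varepsilon$. *)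

(* Defs.v *)
From HB Require Import structures.
From mathcomp Require Import all_boot all_order all_algebra.
From mathcomp Require Import all_classical all_reals all_analysis.
Set Implicit Arguments.
Unset Strict Implicit.
Unset Printing Implicit Defensive.
Import Order.TTheory GRing.Theory Num.Theory.
Import numFieldNormedType.Exports.
Local Open Scope classical_set_scope.
Local Open Scope ring_scope.

(* The library's [completeType] carries a default point; it only serves as the
   junk value of [lim]. *)
#[short(type="completeMetricType")]
HB.structure Definition CompleteMetric (R : realType) :=
  {X of Metric R X & Complete X}.

Section Hadamard.
Context {R : realType}.

(* The norm of ['rV[R]_2] in the library is the sup norm. *)
Definition eucl_dist (P Q : 'rV[R]_2) : R :=
  Num.sqrt (\sum_(i < 2) (P 0 i - Q 0 i) ^+ 2).

Definition plane_segment (P Q : 'rV[R]_2) : set 'rV[R]_2 :=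
  [set (1 - l) *: P + l *: Q | l in `[0, 1]].

Section Metric.
Context {X : metricType R}.

(* Unit-speed geodesic path; values of [c] outside [0, d(u,v)] are irrelevant. *)
Definition geodesic (u v : X) (c : R -> X) : Prop :=
  [/\ c 0 = u, c (mdist u v) = v &
      forall s t, 0 <= s <= mdist u v -> 0 <= t <= mdist u v ->
        mdist (c s) (c t) = `|s - t|].

Definition geodesic_segment (u v : X) (c : R -> X) : set X :=
  c @` `[0, mdist u v].

Definition comparison_triangle (p q r : X) (P Q S : 'rV[R]_2) : Prop :=
  [/\ eucl_dist P Q = mdist p q, eucl_dist P S = mdist p r &
      eucl_dist Q S = mdist q r].

Definition comparison_point (p x : X) (P Q Z : 'rV[R]_2) : Prop :=
  plane_segment P Q Z /\ eucl_dist P Z = mdist p x.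

(* [gconv l u v] is (1 - l) u (+) l v. *)
Definition gconv (l : R) (u v : X) : X :=
  xget u [set w | [/\ exists2 c, geodesic u v c & geodesic_segment u v c w,
    mdist u w = l * mdist u v & mdist v w = (1 - l) * mdist u v]].

Definition nonexpansive (F : X -> X) : Prop :=
  forall u v, mdist (F u) (F v) <= mdist u v.

Definition Fix (F : X -> X) : set X := [set z | F z = z].

Definition cball (y : X) (r : R) : set X := [set z | mdist z y <= r].

(* Takes the value +oo on the empty set. *)
Definition set_dist (u : X) (A : set X) : \bar R :=
  ereal_inf [set (mdist u a)%:E | a in A].

Definition G_map (F : X -> X) (x : X) (t : R) (u : X) : X :=
  gconv (t / (1 + t)) x (F u).

Definition resolvent (F : X -> X) (t : R) (x : X) : X :=
  if t == 0 then x else xget x (Fix (G_map F x t)).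

Definition Fbar (F : X -> X) (y : X) (b : R) (z : X) : \bar R :=
  if mdist z y <= b then (mdist z (F z))%:E else +oo%E.

Definition zer (f : X -> \bar R) : set X := [set z | f z = 0%E].

Definition modulus_of_regularity (f : X -> \bar R) (A : set X) (tau : R -> R)
    : Prop :=
  (forall e, 0 < e -> 0 < tau e) /\
  (forall e, 0 < e -> forall u, A u ->
     (f u < (tau e)%:E)%E -> (set_dist u (zer f) < e%:E)%E).

End Metric.

Definition geodesic_space (X : metricType R) : Prop :=
  forall u v : X, exists c, geodesic u v c.

(* It suffices to compare points on the two sides issuing from [p]: the vertices
   are universally quantified, and for two points on a common side the
   inequality is an equality. *)
Definition cat0 (X : metricType R) : Prop :=
  forall (p q r : X) (cpq cpr cqr : R -> X),
    geodesic p q cpq -> geodesic p r cpr -> geodesic q r cqr ->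
  forall P Q S : 'rV[R]_2, comparison_triangle p q r P Q S ->
  forall x y : X, geodesic_segment p q cpq x -> geodesic_segment p r cpr y ->
  forall Z W : 'rV[R]_2, comparison_point p x P Q Z -> comparison_point p y P S W ->
  mdist x y <= eucl_dist Z W.

Definition hadamard (X : completeMetricType R) : Prop :=
  geodesic_space X /\ cat0 X.

(* The term of index 0 is irrelevant for the limit. *)
Definition semigroup (X : completeMetricType R) (F : X -> X) (t : R) (x : X)
    : X :=
  lim ((fun n : nat => iter n (resolvent F (t / n%:R)) x) @ \oo).

Definition rate (b : nat) (tau : R -> R) (e : R) : R :=
  (Num.ceil (4 * b%:R / tau e * expR (4 * b%:R / tau e)))%:~R + 1.

End Hadamard.

(* Main.v *)
Require Import Defs.
From mathcomp Require Import all_boot all_order all_algebra.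
From mathcomp Require Import all_classical all_reals all_analysis.
From mathcomp Require Import ring lra.
Import Order.TTheory GRing.Theory Num.Theory.
Import numFieldNormedType.Exports.
Local Open Scope classical_set_scope.
Local Open Scope ring_scope.

(** Write [J t] for the resolvent, [T t] for the semigroup and [disp z] for
    [d(z, F z)].  A modulus of regularity turns a small displacement into a
    small distance to the fixed points, so the proof rests on three facts.

    1. The displacement decays like [1 / sqrt t].  The CN inequality, applied to
       [J t x] as a point between [x] and [F (J t x)], gives
       [d(J t x, p)^2 + t disp(J t x)^2 <= d(x, p)^2] for every fixed point [p]
       ([resolvent_fejer]).  Displacement does not increase along the iteration,
       so [n] steps of size [t / n] telescope to
       [t disp^2 <= d(x, p)^2] ([iter_fejer]), and this bound, in which the step
       has disappeared, passes to the limit ([semigroup_disp]).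

    2. The exponential formula converges.  The resolvent identity compares one
       step of size [l] with one step of size [m <= l] ([resolvent_step]), and
       iterating the comparison gives the Crandall-Liggett estimate
       [crandall_liggett].  It makes the sequence defining [T t x] Cauchy, and
       bounds the distance from [k] steps of size [l] to [T s x] by a multiple
       of [sqrt ((k l - s)^2 + s l)] ([iter_semigroup_dist]).

    3. [d(T t x, p)] is nonincreasing in [t] for a fixed point [p]
       ([semigroup_fejer]): it is so along the iterates with step [t / n], and
       by the previous estimate the iterate whose number is the integer part of
       [s n / t] tends to [T s x].  The semigroup law is thus avoided.

    Since [K^2 < K e^K] for [K = 4 b / tau(e)], the given rate exceeds
    [(b / tau(e))^2], so after that time the displacement is below [tau(e)] and
    regularity yields a fixed point within [e]; by monotonicity the trajectory
    stays near that same fixed point, hence is Cauchy as [t] tends to infinity.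

    Nonpositive curvature enters only through [cat0_sides], the comparison
    inequality for points on two sides of a triangle, from which the CN
    inequality and the convexity of the metric follow. *)

Set Implicit Arguments.
Unset Strict Implicit.

(** * Comparison triangles in the plane *)
Section Plane.
Context {R : realType}.
Implicit Types P Q S : 'rV[R]_2.

Lemma eucl_dist_sqr P Q :
  eucl_dist P Q ^+ 2 = (P 0 0 - Q 0 0) ^+ 2 + (P 0 1 - Q 0 1) ^+ 2.
Proof.
rewrite sqr_sqrtr; last by apply: sumr_ge0 => i _; rewrite sqr_ge0.
rewrite big_ord_recl big_ord1 /=.
by have -> : lift ord0 ord0 = 1 :> 'I_2 by apply/val_inj.
Qed.

Lemma eucl_dist_eq P Q a : 0 <= a ->
  (P 0 0 - Q 0 0) ^+ 2 + (P 0 1 - Q 0 1) ^+ 2 = a ^+ 2 -> eucl_dist P Q = a.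
Proof.
move=> a0; rewrite -eucl_dist_sqr => /eqP.
by rewrite eqrXn2// ?sqrtr_ge0// => /eqP.
Qed.

(** The law of cosines: the inner product of [Q - P] and [S - P] is half of
    [PQ^2 + PS^2 - QS^2]. *)
Lemma plane_sides P Q S (l m : R) :
  eucl_dist ((1 - l) *: P + l *: Q) ((1 - m) *: P + m *: S) ^+ 2 =
  l ^+ 2 * eucl_dist P Q ^+ 2 + m ^+ 2 * eucl_dist P S ^+ 2
    - l * m * (eucl_dist P Q ^+ 2 + eucl_dist P S ^+ 2 - eucl_dist Q S ^+ 2).
Proof. by rewrite !eucl_dist_sqr !mxE; ring. Qed.

Lemma eucl_dist_segment P Q (l : R) : 0 <= l ->
  eucl_dist P ((1 - l) *: P + l *: Q) = l * eucl_dist P Q.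
Proof.
move=> l0; apply: eucl_dist_eq; first by rewrite mulr_ge0// sqrtr_ge0.
by rewrite exprMn eucl_dist_sqr !mxE; ring.
Qed.

Lemma comparison_triangle_exists {X : metricType R} (p q r : X) :
  exists P Q S, comparison_triangle p q r P Q S.
Proof.
pose pt (u v : R) : 'rV[R]_2 := \row_j (if j == 0 then u else v).
set a := mdist p q; set b := mdist p r; set c := mdist q r.
have a0 : 0 <= a := mdist_ge0 _ _.
have b0 : 0 <= b := mdist_ge0 _ _.
have c0 : 0 <= c := mdist_ge0 _ _.
have abc : c <= a + b.
  by have := metric_triangle q p r; rewrite (metric_sym q p).
have bac : b <= a + c := metric_triangle p q r.
have acb : a <= b + c.
  by have := metric_triangle p r q; rewrite (metric_sym r q).
have [a_eq0|a_neq0] := eqVneq a 0.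
  have bc : b = c by apply/eqP; rewrite eq_le; lra.
  exists (pt 0 0), (pt 0 0), (pt b 0).
  by split; apply: eucl_dist_eq => //;
    rewrite !mxE/= -?/a -?/b -?/c ?a_eq0 -?bc; ring.
have a_gt0 : 0 < a by rewrite lt_neqAle eq_sym a_neq0.
(* [P] is the origin and [Q] lies on the first axis; [u] is the first coordinate
   of [S] dictated by the law of cosines. *)
pose u := (a ^+ 2 + b ^+ 2 - c ^+ 2) / (2 * a).
have uE : 2 * a * u = a ^+ 2 + b ^+ 2 - c ^+ 2.
  by rewrite /u mulrC divfK// mulf_neq0// pnatr_eq0.
have a2_gt0 : 0 < 2 * a by lra.
have ub : u ^+ 2 <= b ^+ 2.
  have u1 : u <= b.
    by rewrite -(ler_pM2l a2_gt0) uE; nra.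
  have u2 : - b <= u.
    by rewrite -(ler_pM2l a2_gt0) uE; nra.
  nra.
exists (pt 0 0), (pt a 0), (pt u (Num.sqrt (b ^+ 2 - u ^+ 2))).
split; apply: eucl_dist_eq => //; rewrite !mxE/=; first by rewrite -/a; ring.
  by rewrite !sub0r !sqrrN sqr_sqrtr ?subr_ge0// -/b; ring.
rewrite sub0r sqrrN sqr_sqrtr ?subr_ge0// -/c.
have -> : c ^+ 2 = a ^+ 2 + b ^+ 2 - 2 * a * u by rewrite uE; ring.
by ring.
Qed.

End Plane.

(** * Geodesic convex combinations *)
Section Cat0.
Context {R : realType} {X : metricType R}.
Context (geoX : geodesic_space X) (catX : cat0 X).
Implicit Types (u v w x p q r : X) (l m : R).

Lemma gconvP l u v : 0 <= l <= 1 ->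
  [/\ exists2 c, geodesic u v c & geodesic_segment u v c (gconv l u v),
    mdist u (gconv l u v) = l * mdist u v &
    mdist v (gconv l u v) = (1 - l) * mdist u v].
Proof.
move=> /andP[l0 l1]; have [c gc] := geoX u v.
have d0 : 0 <= mdist u v := mdist_ge0 _ _.
have ld : 0 <= l * mdist u v <= mdist u v by apply/andP; split; nra.
case: (gc) => cu cv cd.
rewrite /gconv; case: xgetP => [w _ //|/(_ (c (l * mdist u v)))[]]; split.
- by exists c => //; exists (l * mdist u v) => //=; rewrite in_itv.
- by rewrite -{1}cu cd ?lexx// sub0r normrN ger0_norm//; lra.
- by rewrite -{1}cv cd ?lexx ?andbT// ger0_norm; lra.
Qed.

Lemma gconv1 u v : gconv 1 u v = v.
Proof.
have [_ _ d0] := @gconvP 1 u v ltac:(by rewrite ler01 lexx).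
by apply/esym/mdist_positivity; rewrite d0 subrr mul0r.
Qed.

(** The right-hand side is the squared distance between the comparison points,
    so that no plane triangle has to be mentioned from here on. *)
Lemma cat0_sides p q r l m : 0 <= l <= 1 -> 0 <= m <= 1 ->
  mdist (gconv l p q) (gconv m p r) ^+ 2 <=
  l ^+ 2 * mdist p q ^+ 2 + m ^+ 2 * mdist p r ^+ 2
    - l * m * (mdist p q ^+ 2 + mdist p r ^+ 2 - mdist q r ^+ 2).
Proof.
move=> l01 m01.
have [[c1 g1 s1] e1 _] := gconvP p q l01.
have [[c2 g2 s2] e2 _] := gconvP p r m01.
have [c3 g3] := geoX q r.
have [P [Q [S PQS]]] := comparison_triangle_exists p q r.
have [PQ PS QS] := PQS.
rewrite -PQ -PS -QS -plane_sides ler_pXn2r ?nnegrE ?mdist_ge0 ?sqrtr_ge0//.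
case/andP: (l01) (m01) => l0 l1 /andP[m0 m1].
apply: (catX g1 g2 g3 PQS s1 s2).
  split; first by exists l => //=; rewrite in_itv.
  by rewrite eucl_dist_segment// PQ e1.
split; first by exists m => //=; rewrite in_itv.
by rewrite eucl_dist_segment// PS e2.
Qed.

(** The side on which the second point moves is taken to its endpoint. *)
Lemma cat0_CN p u v l : 0 <= l <= 1 ->
  mdist p (gconv l u v) ^+ 2 <=
  (1 - l) * mdist p u ^+ 2 + l * mdist p v ^+ 2 - l * (1 - l) * mdist u v ^+ 2.
Proof.
move=> l01; have := @cat0_sides u v p l 1 l01 ltac:(by rewrite ler01 lexx).
rewrite gconv1 (metric_sym _ p) (metric_sym u p) (metric_sym v p).
by move/le_trans; apply; rewrite le_eqVlt; apply/orP; left; apply/eqP; ring.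
Qed.

(** By the CN inequality the weighted squared distances of [w] to [u] and [v]
    already exhaust the term [l (1 - l) d(u, v)^2], leaving no room between [w]
    and the combination. *)
Lemma gconv_unique l u v w : 0 <= l <= 1 ->
  mdist u w <= l * mdist u v -> mdist v w <= (1 - l) * mdist u v ->
  w = gconv l u v.
Proof.
move=> /[dup] l01 /andP[l0 l1] wu wv; apply: mdist_positivity; apply/eqP.
rewrite -sqrf_eq0 eq_le sqr_ge0 andbT (le_trans (cat0_CN w u v l01))//.
rewrite (metric_sym w u) (metric_sym w v).
have d0 : 0 <= mdist u v := mdist_ge0 _ _.
have wu2 : mdist u w ^+ 2 <= (l * mdist u v) ^+ 2.
  by rewrite ler_pXn2r ?nnegrE ?mdist_ge0 ?mulr_ge0.
have wv2 : mdist v w ^+ 2 <= ((1 - l) * mdist u v) ^+ 2.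
  by rewrite ler_pXn2r ?nnegrE ?mdist_ge0 ?mulr_ge0// subr_ge0.
have h1 := ler_wpM2l l0 wv2.
have l1' : 0 <= 1 - l by lra.
have h2 := ler_wpM2l l1' wu2.
lra.
Qed.

Lemma gconvC l u v : 0 <= l <= 1 -> gconv l u v = gconv (1 - l) v u.
Proof.
move=> /[dup] l01 /andP[l0 l1]; have [_ e1 e2] := gconvP u v l01.
apply: gconv_unique; rewrite ?(metric_sym v u) ?subKr ?e1 ?e2//; lra.
Qed.

Lemma gconv_ray l p u v : 0 <= l <= 1 ->
  mdist (gconv l p u) (gconv l p v) <= l * mdist u v.
Proof.
move=> /[dup] l01 /andP[l0 l1].
rewrite -(@ler_pXn2r _ 2%N) ?nnegrE ?mdist_ge0 ?mulr_ge0 ?mdist_ge0//.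
rewrite (le_trans (cat0_sides p u v l01 l01))//.
by rewrite le_eqVlt; apply/orP; left; apply/eqP; ring.
Qed.

(** Both segments are compared with the diagonal one from [u] to [v']. *)
Lemma gconv_convex l u v u' v' : 0 <= l <= 1 ->
  mdist (gconv l u v) (gconv l u' v') <= (1 - l) * mdist u u' + l * mdist v v'.
Proof.
move=> /[dup] l01 /andP[l0 l1].
have l01' : 0 <= 1 - l <= 1 by lra.
rewrite (le_trans (metric_triangle _ (gconv l u v') _))// addrC lerD//.
  by rewrite (gconvC u v')// (gconvC u' v')// gconv_ray.
exact: gconv_ray.
Qed.

Lemma gconv_dist l z u v : 0 <= l <= 1 ->
  mdist (gconv l u v) z <= (1 - l) * mdist u z + l * mdist v z.
Proof.
move=> /[dup] l01 /andP[l0 l1].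
have e : z = gconv l z z by apply: gconv_unique; rewrite // mdistxx mulr0.
by rewrite {1}e gconv_convex.
Qed.

End Cat0.

(** * Complete metric spaces *)
Section Complete.
Context {R : realType} {X : completeMetricType R}.
Implicit Types (u : nat -> X) (f : X -> X).

Lemma complete_seq u :
  (forall e : R, 0 < e ->
    exists N, forall n, (N <= n)%N -> mdist (u N) (u n) < e) ->
  exists l : X, u n @[n --> \oo] --> l.
Proof.
move=> cu; exists (lim (u n @[n --> \oo])).
apply: cauchy_cvg; apply/(@cauchyP R) => e e0.
have [N uN] := cu e e0.
exists (u N); exists N => // n /= Nn.
by rewrite ballEmdist; exact: uN.
Qed.

Lemma mdist_cvg_le u l z (c : R) : u n @[n --> \oo] --> l ->
  (\forall n \near \oo, mdist (u n) z <= c) -> mdist l z <= c.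
Proof.
move=> ul uc; apply/ler_addgt0Pr => e e0.
have [n [le_e le_c]] : exists n, mdist l (u n) < e /\ mdist (u n) z <= c.
  have : \forall n \near \oo, mdist l (u n) < e /\ mdist (u n) z <= c.
    near=> n; split; near: n => //.
    exact: metricType_numDomainType.cvgr_dist_lt.
  by move=> /filter_ex.
rewrite (le_trans (metric_triangle _ (u n) _))// addrC.
by rewrite lerD// ltW.
Unshelve. all: by end_near. Qed.

(** Banach's theorem: the orbit of the default point [z] stays within
    [d(z, f z) / (1 - l)] of [z], and its tails shrink by powers of [l]. *)
Lemma contraction_fixpoint f (l : R) : 0 <= l < 1 ->
  (forall v w, mdist (f v) (f w) <= l * mdist v w) -> exists p, Fix f p.
Proof.
move=> /andP[l0 l1] fl; pose z : X := point; pose u n := iter n f z.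
have l1' : 0 < 1 - l by lra.
pose C := mdist z (f z) / (1 - l).
have CE : mdist z (f z) = (1 - l) * C by rewrite mulrC divfK// gt_eqF.
have C0 : 0 <= C by rewrite divr_ge0 ?mdist_ge0// ltW.
have uC k : mdist z (u k) <= C.
  elim: k => [|k IH]; first by rewrite mdistxx.
  rewrite (le_trans (metric_triangle _ (f z) _))//.
  have /le_trans/(_ (ler_wpM2l l0 IH)) := fl z (u k).
  rewrite /u /= CE; lra.
have uN k n : mdist (u n) (u (n + k)%N) <= l ^+ n * C.
  elim: n => [|n IH]; first by rewrite add0n expr0 mul1r.
  rewrite (le_trans (fl _ _))// exprS -mulrA.
  by rewrite ler_wpM2l.
have lC : l ^+ n * C @[n --> \oo] --> (0 : R).
  rewrite -(mul0r C); apply: cvgMr_tmp; apply: cvg_expr.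
  by rewrite ger0_norm.
have [p up] : exists p : X, u n @[n --> \oo] --> p.
  apply: complete_seq => e e0.
  move/cvgr0_norm_lt : lC => /(_ e e0) [N _ /(_ N (leqnn N)) /= lN].
  exists N => n Nn; rewrite -(subnKC Nn) (le_lt_trans (uN _ _))//.
  exact: le_lt_trans (ler_norm _) lN.
exists p; apply/esym/mdist_positivity/eqP; rewrite eq_le mdist_ge0 andbT.
apply/ler_addgt0Pr => e e0; rewrite add0r.
have upS : u n.+1 @[n --> \oo] --> p by rewrite (cvg_shiftS u).
apply: (mdist_cvg_le upS); near=> n.
have pu : mdist p (u n) <= e.
  by near: n; exact: metricType_numDomainType.cvgr_dist_le.
rewrite (le_trans (fl _ _))// (le_trans _ pu)// (metric_sym (u n)).
by rewrite ler_piMl ?mdist_ge0// ltW.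
Unshelve. all: by end_near. Qed.
End Complete.

(** * Resolvents *)
Section Resolvent.
Context {R : realType} {X : completeMetricType R}.
Context (hX : hadamard X) {F : X -> X} (hF : nonexpansive F).
Implicit Types (u v x z p : X) (t s l m : R) (i j n : nat).
Local Notation J := (resolvent F).
Local Notation disp z := (mdist z (F z)).

Let geoX : geodesic_space X := hX.1.
Let catX : cat0 X := hX.2.

Lemma weightP t : 0 < t -> 0 <= t / (1 + t) < 1 /\ t / (1 + t) * (1 + t) = t.
Proof.
move=> t0; have t1 : 0 < 1 + t by lra.
have t0' : 0 <= t / (1 + t) by rewrite divr_ge0 ?ltW.
by rewrite t0' ltr_pdivrMr// divfK ?gt_eqF//; split=> //; lra.
Qed.

Lemma weight_le1 t : 0 < t -> 0 <= t / (1 + t) <= 1.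
Proof. by move=> /weightP[/andP[-> /ltW]]. Qed.

Lemma G_map_contraction t x u v : 0 < t ->
  mdist (G_map F x t u) (G_map F x t v) <= t / (1 + t) * mdist u v.
Proof.
move=> /weightP[/andP[l0 l1] _].
rewrite (le_trans (gconv_ray geoX catX _ _ _ _)) ?l0 ?(ltW l1)//.
by rewrite ler_wpM2l.
Qed.

Lemma resolvent_Fix t x : 0 < t -> Fix (G_map F x t) (J t x).
Proof.
move=> t0; rewrite /resolvent gt_eqF//.
case: xgetP => [z _ //|none].
have [p /none//] := contraction_fixpoint (weightP t0).1
  (fun u v => G_map_contraction x u v t0).
Qed.

(** The fixed-point equation of the resolvent, read as metric betweenness;
    [resolvent_eq] is the converse, and together they reduce the resolvent
    identity to the triangle inequality. *)
Lemma resolvent_dist t x : 0 < t ->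
  mdist x (J t x) = t * disp (J t x) /\
  mdist x (F (J t x)) = (1 + t) * disp (J t x).
Proof.
move=> t0; have := resolvent_Fix x t0; set z := J t x; rewrite /Fix /= /G_map => zE.
have [_] := gconvP geoX x (F z) (weight_le1 t0).
rewrite zE (metric_sym (F z)) => -> ->.
by split; field; rewrite gt_eqF//; lra.
Qed.

Lemma resolvent_eq t x z : 0 < t ->
  mdist x z = t * disp z -> mdist x (F z) = (1 + t) * disp z -> z = J t x.
Proof.
move=> t0 xz xFz; have [/andP[l0 l1] lE] := weightP t0.
have zG : z = G_map F x t z.
  apply: (gconv_unique geoX catX); rewrite ?weight_le1//.
    by rewrite xz xFz mulrA lE.
  by rewrite (metric_sym (F z)) xFz mulrA mulrBl lE mul1r addrK mul1r.
apply: mdist_positivity; apply/eqP; rewrite eq_le mdist_ge0 andbT.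
have := G_map_contraction x z (J t x) t0.
rewrite -zG (resolvent_Fix x t0 : G_map _ _ _ _ = _).
have := mdist_ge0 z (J t x); nra.
Qed.

(** Convexity of the metric bounds the distance [a] of the resolvents by a
    convex combination of [d(u, v)] and [a] itself. *)
Lemma resolvent_nonexpansive t : 0 < t -> nonexpansive (J t).
Proof.
move=> t0 u v; have [/andP[l0 l1] lE] := weightP t0.
have := gconv_convex geoX catX u (F (J t u)) v (F (J t v)) (weight_le1 t0).
rewrite -!/(G_map _ _ _ _) !(resolvent_Fix _ t0 : G_map _ _ _ _ = _).
have := ler_wpM2l l0 (hF (J t u) (J t v)).
by move: (mdist (J t u) _) => a; move: (mdist (F _) _) => c; nra.
Qed.

(** By the resolvent identity, [J l u] is also [J m w] for the point [w] at
    fraction [m / l] of the way from [J l u] back to [u]: it lies between [w]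
    and [F (J l u)], at the distance [m disp(J l u)] from [w]. *)
Lemma resolvent_step l m u v : 0 < m <= l ->
  mdist (J l u) (J m v) <=
  m / l * mdist u v + (1 - m / l) * mdist (J l u) v.
Proof.
move=> /andP[m0 m_le]; have l0 : 0 < l by lra.
have aE : m / l * l = m by rewrite divfK// gt_eqF.
have a01 : 0 <= m / l <= 1 by rewrite ler_pdivrMr// mul1r m_le divr_ge0// ltW.
set a := m / l in aE a01 *; set z := J l u.
have [_ zw uw] := gconvP geoX z u a01; set w := gconv a z u in zw uw.
have [uz uFz] := resolvent_dist u l0; rewrite -/z in uz uFz.
rewrite (metric_sym z u) in zw uw.
have zE : z = J m w.
  apply: resolvent_eq => //; first by rewrite metric_sym zw uz mulrA aE.
  have := metric_triangle w z (F z); have := metric_triangle u w (F z).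
  rewrite uFz uw (metric_sym w z) zw uz => h1 h2.
  by apply/eqP; rewrite eq_le -aE; apply/andP; split; lra.
rewrite {1}zE (le_trans (resolvent_nonexpansive m0 w v))// [leRHS]addrC.
exact: (gconv_dist geoX catX v z u a01).
Qed.

Lemma disp_resolvent t x : 0 < t -> disp (J t x) <= disp x.
Proof.
move=> t0; have [xz xFz] := resolvent_dist x t0.
have := metric_triangle x (F x) (F (J t x)); have := hF x (J t x); lra.
Qed.

Lemma disp_iter t n x : 0 < t -> disp (iter n (J t) x) <= disp x.
Proof.
move=> t0; elim: n => //= n; apply: le_trans.
exact: disp_resolvent.
Qed.

Lemma iter_resolvent_le t n x : 0 < t ->
  mdist x (iter n (J t) x) <= n%:R * t * disp x.
Proof.
move=> t0; elim: n => [|n IH]; first by rewrite mdistxx !mul0r.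
rewrite (le_trans (metric_triangle _ (iter n (J t) x) _))//=.
have [-> _] := resolvent_dist (iter n (J t) x) t0.
have := disp_iter n.+1 x t0; rewrite /= => /(ler_wpM2l (ltW t0)).
rewrite -natr1; lra.
Qed.

(** Induction with [resolvent_step], squared by convexity of the square.  The
    bound is the second moment of a random walk: with [a = m / l] the pair
    [(i, j)] moves to [(i - 1, j - 1)] with probability [a] and to [(i, j - 1)]
    otherwise, which leaves [i l - j m] unchanged on average and contributes the
    variance [m (l - m)], so the inductive step is an equality of the bounds. *)
Lemma crandall_liggett l m x i j : 0 < m <= l ->
  mdist (iter i (J l) x) (iter j (J m) x) ^+ 2 <=
  disp x ^+ 2 * ((i%:R * l - j%:R * m) ^+ 2 + j%:R * m * (l - m)).
Proof.
move=> /[dup] ml /andP[m0 m_le]; have l0 : 0 < l by lra.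
have D0 : 0 <= disp x := mdist_ge0 _ _.
elim: j i => [|j IH] [|i].
- by rewrite mdistxx !mul0r subrr expr0n addr0 mulr0.
- rewrite !mul0r subr0 addr0 -exprMn mulrC metric_sym.
  rewrite ler_pXn2r ?nnegrE ?mdist_ge0 ?mulr_ge0 ?(ltW l0)//.
  exact: iter_resolvent_le.
- rewrite mul0r sub0r sqrrN mulrDr -exprMn mulrC ler_wpDr//.
    by rewrite !mulr_ge0 ?(ltW m0) ?subr_ge0.
  rewrite ler_pXn2r ?nnegrE ?mdist_ge0 ?mulr_ge0 ?(ltW m0)//.
  exact: iter_resolvent_le.
have a01 : 0 <= m / l <= 1 by rewrite ler_pdivrMr// mul1r m_le divr_ge0// ltW.
have aE : m / l * l = m by rewrite divfK// gt_eqF.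
have := resolvent_step (iter i (J l) x) (iter j (J m) x) ml.
move: (IH i) (IH i.+1); rewrite !iterS -!natr1.
set A := mdist (iter i (J l) x) _; set B := mdist (J l _) (iter j (J m) x).
set C := mdist (J l _) (J m _).
set a := m / l in aE a01 *.
have [A0 B0 C0] : [/\ 0 <= A, 0 <= B & 0 <= C] by split; exact: mdist_ge0.
case/andP: a01 => a0 a1 IA IB CAB.
have C2 : C ^+ 2 <= (a * A + (1 - a) * B) ^+ 2.
  have aAB : 0 <= a * A + (1 - a) * B.
    by apply: addr_ge0; apply: mulr_ge0 => //; lra.
  by rewrite ler_pXn2r ?nnegrE.
have conv : (a * A + (1 - a) * B) ^+ 2 <= a * A ^+ 2 + (1 - a) * B ^+ 2.
  rewrite -subr_ge0 (_ : _ - _ = a * (1 - a) * (A - B) ^+ 2); last by ring.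
  by rewrite mulr_ge0 ?sqr_ge0// mulr_ge0// subr_ge0.
have a1' : 0 <= 1 - a by lra.
apply: (le_trans C2); apply: (le_trans conv).
apply: le_trans (lerD (ler_wpM2l a0 IA) (ler_wpM2l a1' IB)) _.
by rewrite le_eqVlt; apply/orP; left; apply/eqP; rewrite -aE; ring.
Qed.

(** The CN inequality at [J t x] with weight [t / (1 + t)], where [F (J t x)] is
    no farther from [p] than [J t x] is.  This yields the coefficient
    [t (1 + t)] for the displacement; keeping only [t] makes the coefficients of
    [n] steps of size [t / n] add up to [t] for every [n]. *)
Lemma resolvent_fejer t x p : 0 < t -> Fix F p ->
  mdist (J t x) p ^+ 2 + t * disp (J t x) ^+ 2 <= mdist x p ^+ 2.
Proof.
move=> t0 pF; have [xz xFz] := resolvent_dist x t0.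
have := cat0_CN geoX catX p x (F (J t x)) (weight_le1 t0).
rewrite -/(G_map _ _ _ _) resolvent_Fix// xFz.
have : mdist p (F (J t x)) ^+ 2 <= mdist p (J t x) ^+ 2.
  by rewrite ler_pXn2r ?nnegrE ?mdist_ge0// -{1}pF.
rewrite !(metric_sym p); move: (mdist (J t x) p) (mdist x p) (disp _) => a c d.
move: (mdist (F _) _) => a' aa'.
have t1 : 0 < 1 + t by lra.
move/(ler_wpM2l (ltW t1)).
have -> : (1 + t) * ((1 - t / (1 + t)) * c ^+ 2 + t / (1 + t) * a' ^+ 2 -
    t / (1 + t) * (1 - t / (1 + t)) * ((1 + t) * d) ^+ 2) =
  c ^+ 2 + t * a' ^+ 2 - t * (1 + t) * d ^+ 2 by field; rewrite gt_eqF.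
have := ler_wpM2l (ltW t0) aa'; have := sqr_ge0 (t * d); lra.
Qed.

(** As the displacements decrease, the last of the [n] displacement terms bounds
    all of them from below. *)
Lemma iter_fejer t x p n : 0 < t -> Fix F p ->
  mdist (iter n (J t) x) p ^+ 2 + n%:R * t * disp (iter n (J t) x) ^+ 2 <=
  mdist x p ^+ 2.
Proof.
move=> t0 pF; elim: n => [|n IH]; first by rewrite !mul0r addr0.
apply: le_trans IH; have := resolvent_fejer (iter n (J t) x) t0 pF.
have : disp (iter n.+1 (J t) x) ^+ 2 <= disp (iter n (J t) x) ^+ 2.
  by rewrite ler_pXn2r ?nnegrE ?mdist_ge0// disp_resolvent.
rewrite -iterS -natr1.
have nt : 0 <= n%:R * t by rewrite mulr_ge0 ?(ltW t0).
move/(ler_wpM2l nt); lra.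
Qed.

Lemma iter_fejer_le t x p n k : 0 < t -> Fix F p ->
  mdist (iter (n + k) (J t) x) p <= mdist (iter k (J t) x) p.
Proof.
move=> t0 pF; rewrite iterD -(@ler_pXn2r _ 2%N) ?nnegrE ?mdist_ge0//.
apply: le_trans (iter_fejer _ n t0 pF).
by rewrite lerDl !mulr_ge0 ?mdist_ge0 ?(ltW t0).
Qed.

End Resolvent.

(** * The semigroup *)
Section Semigroup.
Context {R : realType} {X : completeMetricType R}.
Context (hX : hadamard X) {F : X -> X} (hF : nonexpansive F).
Implicit Types (x p : X) (t s l e : R) (k n : nat).
Local Notation J := (resolvent F).
Local Notation T := (semigroup F).
Local Notation disp z := (mdist z (F z)).

(** With steps [t / N] and [t / n], [N <= n], the Crandall-Liggett bound is
    [disp x^2 (t^2 / N - t^2 / n)]. *)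
Lemma semigroup_cvg t x : 0 < t ->
  iter n (J (t / n%:R)) x @[n --> \oo] --> T t x.
Proof.
move=> t0.
have [p up] : exists p : X, iter n (J (t / n%:R)) x @[n --> \oo] --> p.
  apply: complete_seq => e e0; pose D := disp x.
  have [N N0 DN] : exists2 N, (0 < N)%N & D ^+ 2 * t ^+ 2 < N%:R * e ^+ 2.
    exists (Num.bound (D ^+ 2 * t ^+ 2 / e ^+ 2)).+1 => //.
    rewrite -ltr_pdivrMr ?exprn_gt0// -natr1 ltr_wpDr//.
    by rewrite archi_boundP// -exprMn divr_ge0// sqr_ge0.
  exists N => n Nn; have n0 : (0 < n)%N := leq_trans N0 Nn.
  have N0R : 0 < N%:R :> R by rewrite ltr0n.
  have n0R : 0 < n%:R :> R by rewrite ltr0n.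
  have tnN : 0 < t / n%:R <= t / N%:R.
    rewrite divr_gt0//= ler_pM2l// lef_pV2 ?posrE//.
    by rewrite ler_nat.
  rewrite -(@ltr_pXn2r _ 2%N) ?nnegrE ?mdist_ge0 ?(ltW e0)//.
  apply: le_lt_trans (crandall_liggett hX hF x N n tnN) _.
  have -> : (N%:R * (t / N%:R) - n%:R * (t / n%:R)) ^+ 2 +
      n%:R * (t / n%:R) * (t / N%:R - t / n%:R) =
      t ^+ 2 / N%:R - t ^+ 2 / n%:R.
    by field; rewrite !gt_eqF.
  rewrite -/D (@le_lt_trans _ _ (D ^+ 2 * t ^+ 2 / N%:R))//; last first.
    by rewrite ltr_pdivrMr// [ltRHS]mulrC.
  rewrite -mulrA ler_wpM2l ?sqr_ge0// gerBl divr_ge0 ?sqr_ge0//.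
by rewrite /semigroup (cvg_lim _ up)//; exact: metric_hausdorff.
Qed.

Lemma near_small l t : 0 < l -> 0 < t ->
  \forall n \near \oo, (0 < n)%N /\ 0 < t / n%:R <= l.
Proof.
move=> l0 t0; near=> n.
have n0 : (0 < n)%N by near: n; exists 1%N.
split => //; rewrite divr_gt0 ?ltr0n//= ler_pdivrMr ?ltr0n//.
rewrite mulrC -ler_pdivrMr//.
by near: n; exact: nbhs_infty_ger.
Unshelve. all: by end_near. Qed.

(** The Crandall-Liggett estimate with the smaller step sent to [0]. *)
Lemma iter_semigroup_dist l t k x : 0 < l -> 0 < t ->
  mdist (iter k (J l) x) (T t x) <=
  disp x * Num.sqrt ((k%:R * l - t) ^+ 2 + t * l).
Proof.
move=> l0 t0; rewrite (metric_sym _ (T t x)).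
apply: (mdist_cvg_le (@semigroup_cvg t x t0)).
near=> n.
have [n0 tnl] : (0 < n)%N /\ 0 < t / n%:R <= l.
  by near: n; exact: near_small.
have n0R : 0 < n%:R :> R by rewrite ltr0n.
have S0 : 0 <= (k%:R * l - t) ^+ 2 + t * l.
  by rewrite addr_ge0 ?sqr_ge0// mulr_ge0 ?ltW.
rewrite -(@ler_pXn2r _ 2%N) ?nnegrE ?mulr_ge0 ?mdist_ge0 ?sqrtr_ge0//.
rewrite exprMn sqr_sqrtr// metric_sym.
apply: le_trans (crandall_liggett hX hF x k n tnl) _.
have ntE : n%:R * (t / n%:R) = t by rewrite mulrC divfK// gt_eqF.
rewrite ntE ler_wpM2l ?sqr_ge0// lerD2l ler_wpM2l ?(ltW t0)//.
by rewrite gerBl ltW//; case/andP: tnl.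
Unshelve. all: by end_near. Qed.

(** With step [l = t / n] and [k] the integer part of [s / l], the iterate [n]
    is no farther from [p] than the iterate [k], which is close to [T s x]. *)
Lemma semigroup_fejer s t x p : Fix F p -> 0 < s <= t ->
  mdist (T t x) p <= mdist (T s x) p.
Proof.
move=> pF /andP[s0 st]; have t0 : 0 < t by lra.
apply/ler_addgt0Pr => e e0; apply: (mdist_cvg_le (@semigroup_cvg t x t0)).
(* For steps [l <= t] the error [D sqrt (l^2 + s l)] is at most
   [D sqrt (2 t l)], hence at most [e] when [l <= c]; the summand [1] only
   keeps the denominator positive. *)
pose D := disp x; pose c := e ^+ 2 / ((D ^+ 2 + 1) * (2 * t)).
have D1 : 0 < (D ^+ 2 + 1) * (2 * t).
  by rewrite mulr_gt0 ?ltr_wpDl ?sqr_ge0// mulr_gt0.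
have c0 : 0 < c by rewrite divr_gt0 ?exprn_gt0.
near=> n.
have [n0 /andP[l0 lc]] : (0 < n)%N /\ 0 < t / n%:R <= c.
  by near: n; exact: near_small.
set l := t / n%:R in l0 lc *.
have n1R : 1 <= n%:R :> R by rewrite ler1n.
have nlE : n%:R * l = t by rewrite /l mulrC divfK// gt_eqF// ltr0n.
have lt_ : l <= t by nra.
pose k := Num.truncn (s / l).
have sl0 : 0 <= s / l by rewrite divr_ge0// ltW.
have /andP[ks sk] := truncn_itv sl0; rewrite -/k in ks sk.
rewrite ler_pdivlMr// in ks; rewrite ltr_pdivrMr// -natr1 in sk.
have kn : (k <= n)%N by rewrite -(ler_nat R); nra.
rewrite -(subnK kn) (le_trans (iter_fejer_le hX hF x _ _ l0 pF))//.
rewrite (le_trans (metric_triangle _ (T s x) _))// addrC lerD2l.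
apply: le_trans (iter_semigroup_dist k x l0 s0) _.
rewrite -(@ler_pXn2r _ 2%N) ?nnegrE ?mulr_ge0 ?mdist_ge0 ?sqrtr_ge0 ?(ltW e0)//.
rewrite exprMn sqr_sqrtr; last by rewrite addr_ge0 ?sqr_ge0// mulr_ge0 ?ltW.
rewrite -/D (@le_trans _ _ ((D ^+ 2 + 1) * (2 * t * l)))//; last first.
  by move: lc; rewrite /c ler_pdivlMr//; lra.
apply: ler_pM; rewrite ?sqr_ge0//.
  by rewrite addr_ge0 ?sqr_ge0// mulr_ge0 ?ltW.
  by lra.
have : (k%:R * l - s) ^+ 2 <= l ^+ 2 by nra.
nra.
Unshelve. all: by end_near. Qed.

Lemma semigroup_dist_Fix t x p : Fix F p -> 0 < t ->
  mdist (T t x) p <= mdist x p.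
Proof.
move=> pF t0; apply: (mdist_cvg_le (@semigroup_cvg t x t0)); near=> n.
have [n0 /andP[l0 _]] : (0 < n)%N /\ 0 < t / n%:R <= 1.
  by near: n; exact: near_small.
by have := iter_fejer_le hX hF x n 0 l0 pF; rewrite addn0.
Unshelve. all: by end_near. Qed.

Lemma semigroup_disp t x p : Fix F p -> 0 < t ->
  t * disp (T t x) ^+ 2 <= mdist x p ^+ 2.
Proof.
move=> pF t0; have st0 : 0 < Num.sqrt t by rewrite sqrtr_gt0.
suff h : disp (T t x) <= mdist x p / Num.sqrt t.
  rewrite -{1}(sqr_sqrtr (ltW t0)) -exprMn.
  rewrite ler_pXn2r ?nnegrE ?mulr_ge0 ?mdist_ge0 ?sqrtr_ge0//.
  by rewrite mulrC -ler_pdivlMr.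
apply/ler_addgt0Pr => e e0.
apply: (mdist_cvg_le (@semigroup_cvg t x t0)); near=> n.
have [n0 /andP[l0 _]] : (0 < n)%N /\ 0 < t / n%:R <= 1.
  by near: n; exact: near_small.
have close : mdist (T t x) (iter n (J (t / n%:R)) x) <= e.
  near: n; apply: metricType_numDomainType.cvgr_dist_le e0.
  exact: semigroup_cvg.
set z := iter n _ x in close *.
rewrite (le_trans (metric_triangle _ (F z) _))// lerD//; last first.
  by rewrite (le_trans (hF _ _))// metric_sym.
rewrite ler_pdivlMr// -(@ler_pXn2r _ 2%N) ?nnegrE ?mulr_ge0 ?mdist_ge0
  ?(ltW st0)//.
rewrite exprMn sqr_sqrtr ?(ltW t0)//.
have := iter_fejer hX hF x n l0 pF; rewrite -/z.
rewrite [n%:R * _]mulrC divfK ?gt_eqF ?ltr0n//.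
by have := sqr_ge0 (mdist z p); lra.
Unshelve. all: by end_near. Qed.

End Semigroup.

(** * The rate of convergence *)
Unset Implicit Arguments.

Lemma sqr_lt_mul_expR {R : realType} (K : R) : 0 < K -> K ^+ 2 < K * expR K.
Proof.
move=> K0; rewrite expr2 ltr_pM2l//.
by have := expR_ge1Dx K; lra.
Qed.

(** With [K = 4 b / tau(e)], the rate exceeds [K e^K], hence [K^2], and
    [tau(e)^2 K^2 = 16 b^2]. *)
Lemma rate_gt {R : realType} (b : nat) (tau : R -> R) (e : R) :
  (0 < b)%N -> 0 < tau e -> 0 < rate b tau e /\
  b%:R ^+ 2 < tau e ^+ 2 * rate b tau e.
Proof.
move=> b0 t0; pose K := 4 * b%:R / tau e.
have bR : 0 < b%:R :> R by rewrite ltr0n.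
have K0 : 0 < K by rewrite divr_gt0// mulr_gt0.
have Kr : K ^+ 2 < rate b tau e.
  apply: lt_trans (sqr_lt_mul_expR _ K0) _.
  by rewrite /rate -/K ltr_pwDr ?ltr01 ?ceil_ge.
have KE : tau e * K = 4 * b%:R by rewrite mulrC divfK// gt_eqF.
split; first by apply: le_lt_trans Kr; rewrite sqr_ge0.
have t2 : 0 < tau e ^+ 2 by rewrite exprn_gt0.
rewrite -(ltr_pM2l t2) -exprMn KE in Kr; apply: lt_trans Kr; nra.
Qed.

Theorem theorem4p41 (R : realType) (X : completeMetricType R)
  (hX : hadamard X)
  (F : X -> X) (hF : nonexpansive F)
  (y : X) (hy : Fix F y) (x : X)
  (b : nat) (hb : (1 <= b)%N) (hxy : mdist x y <= b%:R)
  (tau : R -> R)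
  (htau : modulus_of_regularity (Fbar F y b%:R) (cball y b%:R) tau) :
  [/\ forall e : R, 0 < e -> forall t : R, rate b tau e <= t ->
        (set_dist (semigroup F t x) (Fix F) < e%:E)%E,
      forall e : R, 0 < e -> forall t s : R,
        rate b tau (e / 2) <= t -> rate b tau (e / 2) <= s ->
        mdist (semigroup F t x) (semigroup F s x) < e &
      exists xs : X,
        [/\ Fix F xs,
            semigroup F t x @[t --> +oo] --> xs &
            forall e : R, 0 < e -> forall t : R, rate b tau (e / 2) <= t ->
              mdist (semigroup F t x) xs <= e]].
Proof.
set T := semigroup F.
have [tau_gt0 reg] := htau.
have rateP (e : R) : 0 < e -> 0 < rate b tau e /\
    b%:R ^+ 2 < tau e ^+ 2 * rate b tau e.
  by move=> e0; apply: rate_gt => //; exact: tau_gt0.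
have near_fix (e t : R) : 0 < e -> rate b tau e <= t ->
    exists2 p, Fix F p & mdist (T t x) p < e.
  move=> e0 rt; have [r0 br] := rateP e e0; have t0 : 0 < t by lra.
  have Tb : mdist (T t x) y <= b%:R.
    by rewrite (le_trans (semigroup_dist_Fix hX hF x hy t0)).
  have disp_lt : mdist (T t x) (F (T t x)) < tau e.
    rewrite ltNge; apply/negP => taud.
    have := semigroup_disp hX hF x hy t0; rewrite -/T leNgt => /negP; apply.
    have tauP := tau_gt0 e e0.
    apply: (@le_lt_trans _ _ (b%:R ^+ 2)).
      by rewrite ler_pXn2r ?nnegrE ?mdist_ge0.
    apply: (lt_le_trans br); rewrite mulrC.
    apply: ler_pM => //; rewrite ?(ltW r0) ?sqr_ge0//.
    by rewrite ler_pXn2r ?nnegrE ?mdist_ge0// ltW.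
  have : (set_dist (T t x) (zer (Fbar F y b%:R)) < e%:E)%E.
    by apply: reg => //; rewrite /Fbar Tb lte_fin.
  move=> /ereal_inf_lt[_ /= [p pz <-]]; rewrite lte_fin => Tp.
  exists p => //; move: pz; rewrite /zer /Fbar /=; case: ifP => // _ [].
  by move=> /mdist_positivity/esym.
have cauchy (e t s : R) : 0 < e ->
    rate b tau (e / 2) <= t -> rate b tau (e / 2) <= s ->
    mdist (T t x) (T s x) < e.
  move=> e0 rt rs; have e2 : 0 < e / 2 by lra.
  have [r0 _] := rateP _ e2.
  (* The fixed point found at the time [rate b tau (e / 2)] serves all later
     times. *)
  have [p pF Tp] := near_fix _ _ e2 (lexx _).
  have h u : rate b tau (e / 2) <= u -> mdist (T u x) p < e / 2.
    by move=> ru; apply: le_lt_trans Tp; apply: semigroup_fejer; rewrite // r0.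
  rewrite (le_lt_trans (metric_triangle _ p _))// (splitr e).
  by rewrite ltrD ?h// metric_sym h.
have [xs Txs] : exists xs : X, T n%:R x @[n --> \oo] --> xs.
  apply: complete_seq => e e0; set r := rate b tau (e / 2).
  have e2 : 0 < e / 2 by lra.
  have r0 : 0 < r := (rateP _ e2).1.
  have rN := ltW (archi_boundP (ltW r0)).
  exists (Num.bound r) => n Nn; apply: cauchy => //.
  by rewrite (le_trans rN)// ler_nat.
have T_xs (e t : R) : 0 < e -> rate b tau (e / 2) <= t -> mdist (T t x) xs <= e.
  move=> e0 rt; rewrite metric_sym; apply: (mdist_cvg_le Txs); near=> n.
  by apply/ltW/cauchy => //; near: n; exact: nbhs_infty_ger.
split => //.
- move=> e e0 t /(near_fix _ _ e0)[p pF Tp].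
  apply: (@le_lt_trans _ _ (mdist (T t x) p)%:E) => //.
  by apply: ereal_inf_lbound; exists p.
- by move=> e e0 t s; exact: cauchy.
exists xs; split => //.
- apply/esym/mdist_positivity/eqP; rewrite eq_le mdist_ge0 andbT.
  apply/ler_addgt0Pr => e e0; rewrite add0r.
  have e4 : 0 < e / 4 by lra.
  (* At this time [T t x] is within [e / 4] both of [xs] and of a fixed point. *)
  pose t := Num.max (rate b tau (e / 4)) (rate b tau (e / 4 / 2)).
  have [||p pF Tp] := near_fix (e / 4) t => //; first by rewrite le_max lexx.
  have Txs4 : mdist (T t x) xs <= e / 4 by rewrite T_xs// le_max lexx orbT.
  have xsp : mdist xs p <= e / 2.
    have := metric_triangle xs (T t x) p.
    by rewrite (metric_sym xs (T t x)); lra.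
  have := metric_triangle xs p (F xs); have := hF p xs.
  by rewrite (pF : F p = p) (metric_sym p xs); lra.
- apply/metricType_numDomainType.cvgrPdist_lt => e e0.
  have e2 : 0 < e / 2 by lra.
  near=> t; rewrite metric_sym (@le_lt_trans _ _ (e / 2))//; last by lra.
  by apply: T_xs => //; near: t; apply: nbhs_pinfty_ge; exact: num_real.
- by move=> e e0 t; exact: T_xs.
Unshelve. all: by end_near. Qed.
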